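(* (i) For every associative pair $(\mathbb{A}^+,\mathbb{A}^-)$ over $\mathbb{K}$ there exists an associative geometry $\mathcal{X}$ over $\mathbb{K}$ with base point $(o^+,o^-)$ having $(\mathbb{A}^+,\mathbb{A}^-)$ (up to isomorphism of associative pairs) as associated pair. (ii) For every unital associative $\mathbb{K}$-algebra $(\mathbb{A},1)$ there exists an associative geometry $\mathcal{X}$ over $\mathbb{K}$ with transversal triple $(o^+,\Delta,o^-)$ having $(\mathbb{A},1)$ (up to isomorphism of unital algebras) as associated algebra.
   Context: $\mathbb{K}$ is a commutative unital ring. An associative geometry over $\mathbb{K}$ is a set $\mathcal{X}$ which is a complete lattice (join $\lor$, meet $\land$, least element $0$, greatest element $1$) with maps $\Gamma:\mathcal{X}^5\to\mathcal{X}$ and $\Pi_s:\mathcal{X}^3\to\mathcal{X}$ ($s\in\mathbb{K}$) satisfying (1)–(6) below. Notation: $L_{xayb}(z):=M_{xabz}(y):=R_{aybz}(x):=\Gamma(x,a,y,b,z)$; $x\top y$ (transversal) means $x\land y=0$ and $x\lor y=1$; $C_a=\{x: x\top a\}$, $C_{ab}=C_a\cap C_b$; $U_a$ denotes $C_a$ with the affine structure of (5). (1) For all $x,y,z,u,v,a,b$: $\Gamma(\Gamma(x,a,y,b,z),a,u,b,v)=\Gamma(x,a,\Gamma(u,a,z,b,y),b,v)=\Gamma(x,a,y,b,\Gamma(z,a,u,b,v))$. (2) For all $x,a,y,b,z$: $\Gamma(x,a,y,b,z)=\Gamma(z,b,y,a,x)$ and $\Gamma(x,a,y,b,z)=\Gamma(a,x,y,z,b)$.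 (3) For all $x,a,y,b,z$, the pairs $(L_{xayb},L_{yaxb})$, $(M_{xabz},M_{zabx})$, $(R_{aybz},R_{azby})$ are structural; a pair $g:\mathcal{X}\to\mathcal{Y}$, $h:\mathcal{Y}\to\mathcal{X}$ is structural if $g(\Gamma(x,h(u),y,h(v),z))=\Gamma(g(x),u,g(y),v,g(z))$ and $g(\Pi_r(x,h(u),y))=\Pi_r(g(x),u,g(y))$ for all arguments and all $r\in\mathbb{K}$, and likewise with $g,h$ exchanged. (4) (i) $\Gamma(a,a,y,b,b)=a\lor b$ for all $a,b,y$; (ii) $\Gamma(a,b,y,a,b)=a\land b$ for all $a,b,y$; (iii) if $x\in C_{ab}$ then $\Gamma(x,a,x,b,z)=z=\Gamma(z,b,x,a,x)$ for all $z$; (iv) if $a\top x$ and $y\top b$ then $\Gamma(x,a,y,b,b)=b$; (v) if $a\top y$ and $b\top x$ then $\Gamma(x,a,y,b,a)=a$. (5) For all $a\in\mathcal{X}$, $r\in\mathbb{K}$: $\Pi_r(x,a,y)\in C_a$ for $x,y\in C_a$, and $C_a$ is an affine space over $\mathbb{K}$ with additive torsor structure $x-y+z=\Gamma(x,a,y,a,z)$ and scalar action $r\cdot_x y=(1-r)x+ry=\Pi_r(x,a,y)$. (Thus choosing an origin $o\in C_a$ makes $C_a$ a $\mathbb{K}$-module with addition $x+z=\Gamma(x,a,o,a,z)$ and scalars $r\cdot y=\Pi_r(o,a,y)$.) (6) For all $a,b$: $\Gamma(U_a,a,U_b,b,U_a)\subset U_a$ and $\Gamma(U_b,a,U_a,b,U_b)\subset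 U_b$. An associative pair over $\mathbb{K}$ is a pair $(\mathbb{A}^+,\mathbb{A}^-)$ of $\mathbb{K}$-modules with trilinear maps $\langle\cdot\,\cdot\,\cdot\rangle^\pm:\mathbb{A}^\pm\times\mathbb{A}^\mp\times\mathbb{A}^\pm\to\mathbb{A}^\pm$ satisfying $\langle xy\langle zuv\rangle^\pm\rangle^\pm=\langle\langle xyz\rangle^\pm uv\rangle^\pm=\langle x\langle uzy\rangle^\mp v\rangle^\pm$. A base point is a transversal pair $(o^+,o^-)$ in $\mathcal{X}$. Its associated pair is $(U_{o^-},U_{o^+})$, with origins $o^+$ resp. $o^-$ and products $\langle xbz\rangle^+=\Gamma(x,o^-,b,o^+,z)$, $\langle ayc\rangle^-=\Gamma(a,o^-,y,o^+,c)$ (this is an associative pair). For a transversal triple $(a,u,c)$ (three mutually transversal elements), the associated algebra is $U_c$ with origin $a$, unit $u$ and product $xz=\Gamma(x,a,u,c,z)$ (this is a unital associative $\mathbb{K}$-algebra). *)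

(* Defs.v *)
From HB Require Import structures.
From mathcomp Require Import all_boot all_order all_algebra.
From mathcomp Require Import classical_sets.

Set Implicit Arguments.
Unset Strict Implicit.
Unset Printing Implicit Defensive.

Import Order.TTheory GRing.Theory.
Local Open Scope ring_scope.

(* MathComp's algType is not used because it excludes the zero algebra. *)
Record unitalAlg (K : comPzRingType) := UnitalAlg {
  alg_mod :> lmodType K;
  alg_mul : alg_mod -> alg_mod -> alg_mod;
  alg_one : alg_mod;
  alg_mul_linearl : forall y, linear (fun x => alg_mul x y);
  alg_mul_linearr : forall x, linear (fun y => alg_mul x y);
  alg_mulA : associative alg_mul;
  alg_1mul : left_id alg_one alg_mul;
  alg_mul1 : right_id alg_one alg_mul
}.

Definition alg_isomorphic (K : comPzRingType) (A B : unitalAlg K) : Prop :=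
  exists f : {linear A -> B},
    [/\ bijective f, forall x y, f (alg_mul x y) = alg_mul (f x) (f y)
      & f (alg_one A) = alg_one B].

Record assocPair (K : comPzRingType) := AssocPair {
  pairp : lmodType K;
  pairm : lmodType K;
  prodp : pairp -> pairm -> pairp -> pairp;
  prodm : pairm -> pairp -> pairm -> pairm;
  prodp_linear1 : forall y z, linear (fun x => prodp x y z);
  prodp_linear2 : forall x z, linear (fun y => prodp x y z);
  prodp_linear3 : forall x y, linear (fun z => prodp x y z);
  prodm_linear1 : forall y z, linear (fun x => prodm x y z);
  prodm_linear2 : forall x z, linear (fun y => prodm x y z);
  prodm_linear3 : forall x y, linear (fun z => prodm x y z);
  prodpA : forall x y z u v,
    prodp x y (prodp z u v) = prodp (prodp x y z) u v;
  prodpAC : forall x y z u v,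
    prodp (prodp x y z) u v = prodp x (prodm u z y) v;
  prodmA : forall x y z u v,
    prodm x y (prodm z u v) = prodm (prodm x y z) u v;
  prodmAC : forall x y z u v,
    prodm (prodm x y z) u v = prodm x (prodp u z y) v
}.

Definition pair_isomorphic (K : comPzRingType) (A B : assocPair K) : Prop :=
  exists (fp : {linear pairp A -> pairp B}) (fm : {linear pairm A -> pairm B}),
    [/\ bijective fp, bijective fm,
        forall x y z, fp (prodp x y z) = prodp (fp x) (fm y) (fp z)
      & forall x y z, fm (prodm x y z) = prodm (fm x) (fp y) (fm z)].

Definition complete_lattice d (X : tbLatticeType d) : Prop :=
  forall S : set X, (supremums S !=set0 /\ infimums S !=set0)%classic.

Definition transversal_pair d (X : tbLatticeType d) (x y : X) : bool :=
  ((x `&` y == \bot) && (x `|` y == \top))%O.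

Definition Cset d (X : tbLatticeType d) (a : X) : {pred X} :=
  [pred x | transversal_pair x a].

Definition struct_morph (K : pzRingType) (X Y : Type)
    (GX : X -> X -> X -> X -> X -> X) (PX : K -> X -> X -> X -> X)
    (GY : Y -> Y -> Y -> Y -> Y -> Y) (PY : K -> Y -> Y -> Y -> Y)
    (g : X -> Y) (h : Y -> X) : Prop :=
  (forall x u y v z, g (GX x (h u) y (h v) z) = GY (g x) u (g y) v (g z)) /\
  (forall r x u y, g (PX r x (h u) y) = PY r (g x) u (g y)).

Definition structural (K : pzRingType) (X Y : Type)
    (GX : X -> X -> X -> X -> X -> X) (PX : K -> X -> X -> X -> X)
    (GY : Y -> Y -> Y -> Y -> Y -> Y) (PY : K -> Y -> Y -> Y -> Y)
    (g : X -> Y) (h : Y -> X) : Prop :=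
  struct_morph GX PX GY PY g h /\ struct_morph GY PY GX PX h g.

(* The (possibly empty) subset C of T, with tor x y z read as x - y + z and
   dil r x y read as (1 - r) x + r y, is an affine space: every o in C is the
   zero of a module with addition tor x o y and scalars dil r o x, and tor and
   dil are the expected combinations in each of these modules. That
   tor x y z = x - y + z with respect to every origin follows from torA. *)
Record affine_space (K : pzRingType) (T : Type) (C : {pred T})
    (tor : T -> T -> T -> T) (dil : K -> T -> T -> T) : Prop := AffineSpace {
  tor_closed : forall x y z, x \in C -> y \in C -> z \in C -> tor x y z \in C;
  dil_closed : forall r x y, x \in C -> y \in C -> dil r x y \in C;
  torK : forall x y, x \in C -> y \in C -> tor x y y = x;
  torC : forall x y z, x \in C -> y \in C -> z \in C -> tor x y z = tor z y x;
  torA : forall x y z u v, x \in C -> y \in C -> z \in C -> u \in C -> v \in C ->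
    tor (tor x y z) u v = tor x y (tor z u v);
  dil1 : forall o x, o \in C -> x \in C -> dil 1 o x = x;
  dilA : forall r s o x, o \in C -> x \in C ->
    dil r o (dil s o x) = dil (r * s) o x;
  dilDr : forall r o x y, o \in C -> x \in C -> y \in C ->
    dil r o (tor x o y) = tor (dil r o x) o (dil r o y);
  dilDl : forall r s o x, o \in C -> x \in C ->
    dil (r + s) o x = tor (dil r o x) o (dil s o x);
  dilE : forall r o x y, o \in C -> x \in C -> y \in C ->
    dil r x y = tor (dil (1 - r) o x) o (dil r o y)
}.

(* Gam is the quintary product map Gamma; Dil r is the dilation map Pi_r. *)
HB.mixin Record isAssocGeometry (K : comPzRingType) d X
    of Order.TBLattice d X := {
  Gam : X -> X -> X -> X -> X -> X;
  Dil : K -> X -> X -> X -> X;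
  geom_complete : complete_lattice X;
  GamA : forall x y z u v a b : X,
    Gam (Gam x a y b z) a u b v = Gam x a y b (Gam z a u b v);
  GamAC : forall x y z u v a b : X,
    Gam (Gam x a y b z) a u b v = Gam x a (Gam u a z b y) b v;
  Gam_rev : forall x a y b z : X, Gam x a y b z = Gam z b y a x;
  Gam_swap : forall x a y b z : X, Gam x a y b z = Gam a x y z b;
  Gam_structL : forall x a y b : X, structural Gam Dil Gam Dil
    (fun z => Gam x a y b z) (fun z => Gam y a x b z);
  Gam_structM : forall x a b z : X, structural Gam Dil Gam Dil
    (fun y => Gam x a y b z) (fun y => Gam z a y b x);
  Gam_structR : forall a y b z : X, structural Gam Dil Gam Dil
    (fun x => Gam x a y b z) (fun x => Gam x a z b y);
  Gam_join : forall a b y : X, Gam a a y b b = (a `|` b)%O;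
  Gam_meet : forall a b y : X, Gam a b y a b = (a `&` b)%O;
  Gam_unitl : forall x a b z : X, x \in Cset a -> x \in Cset b ->
    Gam x a x b z = z;
  Gam_unitr : forall x a b z : X, x \in Cset a -> x \in Cset b ->
    Gam z b x a x = z;
  Gam_absb : forall x a y b : X, transversal_pair a x -> transversal_pair y b ->
    Gam x a y b b = b;
  Gam_absa : forall x a y b : X, transversal_pair a y -> transversal_pair b x ->
    Gam x a y b a = a;
  Gam_affine : forall a : X,
    affine_space (Cset a) (fun x y z => Gam x a y a z) (fun r x y => Dil r x a y);
  Gam_aba : forall a b x y z : X,
    x \in Cset a -> y \in Cset b -> z \in Cset a -> Gam x a y b z \in Cset a;
  Gam_bab : forall a b x y z : X,
    x \in Cset b -> y \in Cset a -> z \in Cset b -> Gam x a y b z \in Cset b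
}.

#[short(type="assocGeometryType")]
HB.structure Definition AssocGeometry (K : comPzRingType) d :=
  {X of Order.TBLattice d X & isAssocGeometry K d X}.

Lemma transversal_pairC d (X : tbLatticeType d) (x y : X) :
  transversal_pair x y = transversal_pair y x.
Proof. by rewrite /transversal_pair meetC joinC. Qed.

Definition transversal_triple d (X : tbLatticeType d) (a u c : X) : bool :=
  [&& transversal_pair a u, transversal_pair u c & transversal_pair a c].

Section AffineModule.
Variables (K : comPzRingType) (d : Order.disp_t) (X : assocGeometryType K d).

(* U_a, regarded as a module with origin o. *)
Definition affmod (a : X) (o : {x : X | x \in Cset a}) : Type :=
  {x : X | x \in Cset a}.

Variables (a : X) (o : {x : X | x \in Cset a}).
Local Notation U := (affmod o).

HB.instance Definition _ := Choice.copy U {x : X | x \in Cset a}.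

Let inC (x : {x : X | x \in Cset a}) : sval x \in Cset a.
Proof. by case: x. Qed.

Definition affmod_add (x z : U) : U :=
  exist _ (Gam (sval x) a (sval o) a (sval z))
    (tor_closed (Gam_affine a) (svalP x) (svalP o) (svalP z)).
Definition affmod_opp (x : U) : U :=
  exist _ (Gam (sval o) a (sval x) a (sval o))
    (tor_closed (Gam_affine a) (svalP o) (svalP x) (svalP o)).
Definition affmod_scale (r : K) (x : U) : U :=
  exist _ (Dil r (sval o) a (sval x))
    (dil_closed (Gam_affine a) r (svalP o) (svalP x)).

Fact affmod_addA : associative affmod_add.
Proof.
move=> x y z; apply: val_inj => /=.
by rewrite (torA (Gam_affine a)) // inC.
Qed.
Fact affmod_addC : commutative affmod_add.
Proof.
move=> x y; apply: val_inj => /=.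
by rewrite (torC (Gam_affine a)) // inC.
Qed.
Fact affmod_add0 : left_id (o : U) affmod_add.
Proof.
move=> x; apply: val_inj => /=.
by rewrite (torC (Gam_affine a)) ?(torK (Gam_affine a)) ?inC.
Qed.
Fact affmod_addN : left_inverse (o : U) affmod_opp affmod_add.
Proof.
move=> x; apply: val_inj => /=.
rewrite (torA (Gam_affine a)) ?inC // (torC (Gam_affine a) (z := sval x)) ?inC //.
by rewrite !(torK (Gam_affine a)) ?inC // (torC (Gam_affine a)) ?(torK (Gam_affine a)) ?inC.
Qed.
HB.instance Definition _ := GRing.isZmodule.Build U
  affmod_addA affmod_addC affmod_add0 affmod_addN.

Fact affmod_scaleA r s (x : U) :
  affmod_scale r (affmod_scale s x) = affmod_scale (r * s) x.
Proof. by apply: val_inj => /=; rewrite (dilA (Gam_affine a)) ?inC. Qed.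
Fact affmod_scale1 : left_id 1 affmod_scale.
Proof. by move=> x; apply: val_inj => /=; rewrite (dil1 (Gam_affine a)) ?inC. Qed.
Fact affmod_scaleDr : right_distributive affmod_scale +%R.
Proof. by move=> r x y; apply: val_inj => /=; rewrite (dilDr (Gam_affine a)) ?inC. Qed.
Fact affmod_scaleDl (x : U) : {morph affmod_scale^~ x : r s / r + s}.
Proof. by move=> r s; apply: val_inj => /=; rewrite (dilDl (Gam_affine a)) ?inC. Qed.
HB.instance Definition _ := GRing.Zmodule_isLmodule.Build K U
  affmod_scaleA affmod_scale1 affmod_scaleDr affmod_scaleDl.

End AffineModule.

Lemma affmod_linear (K : comPzRingType) d (X : assocGeometryType K d) (a a' : X)
    (o : {x : X | x \in Cset a}) (o' : {x : X | x \in Cset a'})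
    (g h : X -> X) (f : affmod o -> affmod o') :
  structural Gam (@Dil K d X) Gam (@Dil K d X) g h ->
  h a' = a -> g (sval o) = sval o' ->
  (forall x, sval (f x) = g (sval x)) -> linear f.
Proof.
move=> [[gG gP] _] ha go fE r x y.
have gGa t v w : g (Gam t a v a w) = Gam (g t) a' (g v) a' (g w).
  by rewrite -gG !ha.
have gPa s t v : g (Dil s t a v) = Dil s (g t) a' (g v) by rewrite -gP !ha.
by apply: val_inj; rewrite /= !fE /= gGa gPa go.
Qed.

Lemma Gam_origin (K : comPzRingType) d (X : assocGeometryType K d) (a b x z : X) :
  transversal_pair a b -> transversal_pair a x -> transversal_pair a z -> Gam x a a b z = b.
Proof.
move=> ab ax az; have ba : transversal_pair b a by rewrite transversal_pairC.
rewrite -{2}(Gam_absa a a b b ab ba) -GamAC Gam_absb //.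
by rewrite Gam_rev Gam_absa.
Qed.

Section AssociatedPair.
Variables (K : comPzRingType) (d : Order.disp_t) (X : assocGeometryType K d).
Variables (op om : X) (tr : transversal_pair op om).

Let trC : transversal_pair om op. Proof. by rewrite transversal_pairC. Qed.

Definition originp : {x : X | x \in Cset om} := exist _ op tr.
Definition originm : {x : X | x \in Cset op} := exist _ om trC.

Definition assoc_prodp (x : affmod originp) (b : affmod originm)
    (z : affmod originp) : affmod originp :=
  exist _ (Gam (sval x) om (sval b) op (sval z))
    (Gam_aba _ _ _ _ _ (svalP x) (svalP b) (svalP z)).
Definition assoc_prodm (a : affmod originm) (y : affmod originp)
    (c : affmod originm) : affmod originm :=
  exist _ (Gam (sval a) om (sval y) op (sval c))
    (Gam_bab _ _ _ _ _ (svalP a) (svalP y) (svalP c)).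

Let pP (x : affmod originp) : transversal_pair (sval x) om. Proof. exact: svalP x. Qed.
Let mP (x : affmod originm) : transversal_pair (sval x) op. Proof. exact: svalP x. Qed.
Let pPC (x : affmod originp) : transversal_pair om (sval x).
Proof. by rewrite transversal_pairC pP. Qed.
Let mPC (x : affmod originm) : transversal_pair op (sval x).
Proof. by rewrite transversal_pairC mP. Qed.

Fact assoc_prodp_linear1 y z : linear (fun x => assoc_prodp x y z).
Proof.
apply: (affmod_linear (Gam_structR om (sval y) op (sval z))) => //=.
  by rewrite Gam_rev Gam_absb.
by rewrite Gam_rev Gam_absa.
Qed.
Fact assoc_prodp_linear2 x z : linear (fun y => assoc_prodp x y z).
Proof.
by apply: (affmod_linear (Gam_structM (sval x) om op (sval z))) => //=;
  rewrite Gam_origin.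
Qed.
Fact assoc_prodp_linear3 x y : linear (fun z => assoc_prodp x y z).
Proof.
apply: (affmod_linear (Gam_structL (sval x) om (sval y) op)) => //=.
  by rewrite Gam_absa.
by rewrite Gam_absb.
Qed.
Fact assoc_prodm_linear1 y z : linear (fun x => assoc_prodm x y z).
Proof.
apply: (affmod_linear (Gam_structR om (sval y) op (sval z))) => //=.
  by rewrite Gam_rev Gam_absa.
by rewrite Gam_rev Gam_absb.
Qed.
Fact assoc_prodm_linear2 x z : linear (fun y => assoc_prodm x y z).
Proof.
by apply: (affmod_linear (Gam_structM (sval x) om op (sval z))) => //=;
  rewrite Gam_rev Gam_origin.
Qed.
Fact assoc_prodm_linear3 x y : linear (fun z => assoc_prodm x y z).
Proof.
apply: (affmod_linear (Gam_structL (sval x) om (sval y) op)) => //=.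
  by rewrite Gam_absb.
by rewrite Gam_absa.
Qed.
Fact assoc_prodpA x y z u v :
  assoc_prodp x y (assoc_prodp z u v) = assoc_prodp (assoc_prodp x y z) u v.
Proof. by apply: val_inj => /=; rewrite GamA. Qed.
Fact assoc_prodpAC x y z u v :
  assoc_prodp (assoc_prodp x y z) u v = assoc_prodp x (assoc_prodm u z y) v.
Proof. by apply: val_inj => /=; rewrite GamAC. Qed.
Fact assoc_prodmA x y z u v :
  assoc_prodm x y (assoc_prodm z u v) = assoc_prodm (assoc_prodm x y z) u v.
Proof. by apply: val_inj => /=; rewrite GamA. Qed.
Fact assoc_prodmAC x y z u v :
  assoc_prodm (assoc_prodm x y z) u v = assoc_prodm x (assoc_prodp u z y) v.
Proof. by apply: val_inj => /=; rewrite GamAC. Qed.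

Definition associated_pair : assocPair K :=
  AssocPair assoc_prodp_linear1 assoc_prodp_linear2 assoc_prodp_linear3
    assoc_prodm_linear1 assoc_prodm_linear2 assoc_prodm_linear3
    assoc_prodpA assoc_prodpAC assoc_prodmA assoc_prodmAC.

End AssociatedPair.

Section AssociatedAlgebra.
Variables (K : comPzRingType) (d : Order.disp_t) (X : assocGeometryType K d).
Variables (a u c : X) (tr : transversal_triple a u c).

Let au : transversal_pair a u. Proof. by case/and3P: tr. Qed.
Let uc : transversal_pair u c. Proof. by case/and3P: tr. Qed.
Let ac : transversal_pair a c. Proof. by case/and3P: tr. Qed.
Let ua : transversal_pair u a. Proof. by rewrite transversal_pairC. Qed.

Definition origin_alg : {x : X | x \in Cset c} := exist _ a ac.
Local Notation U := (affmod origin_alg).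

Definition assoc_one : U := exist _ u uc.
Definition assoc_mul (x z : U) : U :=
  exist _ (Gam (sval x) a u c (sval z)) (Gam_bab _ _ _ _ _ (svalP x) ua (svalP z)).

Let xc (x : U) : transversal_pair (sval x) c. Proof. exact: svalP x. Qed.
Let cx (x : U) : transversal_pair c (sval x). Proof. by rewrite transversal_pairC xc. Qed.

Fact assoc_mul_linearl z : linear (fun x => assoc_mul x z).
Proof.
apply: (affmod_linear (Gam_structR a u c (sval z))) => //=.
  by rewrite Gam_rev Gam_absa.
by rewrite Gam_rev Gam_absb.
Qed.
Fact assoc_mul_linearr x : linear (fun z => assoc_mul x z).
Proof.
apply: (affmod_linear (Gam_structL (sval x) a u c)) => //=.
  by rewrite Gam_absb.
by rewrite Gam_absa.
Qed.
Fact assoc_mulA : associative assoc_mul.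
Proof. by move=> x y z; apply: val_inj => /=; rewrite GamA. Qed.
Fact assoc_1mul : left_id assoc_one assoc_mul.
Proof. by move=> x; apply: val_inj => /=; rewrite Gam_unitl. Qed.
Fact assoc_mul1 : right_id assoc_one assoc_mul.
Proof. by move=> x; apply: val_inj => /=; rewrite Gam_unitr. Qed.

Definition associated_algebra : unitalAlg K :=
  UnitalAlg assoc_mul_linearl assoc_mul_linearr assoc_mulA assoc_1mul assoc_mul1.

End AssociatedAlgebra.

(* Main.v *)
(* The set of all subspaces of a K-module W that are stable under a family of
   operators is an associative geometry, with
     Gam x a y b z = {w | w = ze + al = al + eta + be = xi + be} and
     Pi_r x a y = {(1 - r) xi + r eta | eta - xi in a}
   for xi in x, al in a, eta in y, be in b, ze in z: the maps L, M, R are images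
   under linear relations, which makes them structural, and the affine
   identities only need one inclusion, since comparable complements of a given
   subspace are equal. If op is generated by one element e, the complements of om
   are the subspaces generated by e + n, where n runs over suitable elements of
   om. For a unital algebra A take W = A + A with op = A + 0, om = 0 + A, Delta
   the diagonal, and the left multiplications as operators; a in A corresponds to
   the subspace generated by (1, a). For an associative pair take the part
   generated by the two Peirce idempotents in (a model of) the right regular
   module of the standard imbedding, which is an algebra with Peirce components
   A_qp = A^+ and A_pq = A^-. *)
Require Import Defs.
From HB Require Import structures.
From mathcomp Require Import all_boot all_order all_algebra.
From mathcomp Require Import boolp classical_sets functions.

Set Implicit Arguments.
Unset Strict Implicit.
Unset Printing Implicit Defensive.

Import Order.TTheory GRing.Theory.
Local Open Scope ring_scope.

(** * Deciding identities in abelian groups *)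

Inductive zexp := ZVar of nat | ZZero | ZOpp of zexp | ZAdd of zexp & zexp.

Fixpoint zeval (V : zmodType) (env : seq V) (e : zexp) : V :=
  match e with
  | ZVar n => env`_n
  | ZZero => 0
  | ZOpp e1 => - zeval env e1
  | ZAdd e1 e2 => zeval env e1 + zeval env e2
  end.

Fixpoint zcoef (e : zexp) (i : nat) : int :=
  match e with
  | ZVar n => (n == i)%:R
  | ZZero => 0
  | ZOpp e1 => - zcoef e1 i
  | ZAdd e1 e2 => zcoef e1 i + zcoef e2 i
  end.

(** An expression is determined by the integer coefficients of its atoms, a variable outside [env]
    counting as 0; so [zmod] proves an identity by computing coefficients. *)
Lemma zevalE (V : zmodType) (env : seq V) (e : zexp) :
  zeval env e = \sum_(i < size env) env`_i *~ zcoef e i.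
Proof.
elim: e => [n||e IHe|e1 IH1 e2 IH2] /=.
- have [lt_n|ge_n] := ltnP n (size env); last first.
    rewrite nth_default // big1 // => i _.
    by rewrite gtn_eqF ?mulr0z // (leq_trans _ ge_n).
  rewrite (bigD1 (Ordinal lt_n)) //= eqxx mulr1z big1 ?addr0 // => i ne_i.
  by rewrite -val_eqE /= eq_sym in ne_i; rewrite (negPf ne_i) mulr0z.
- by rewrite big1 // => i _; rewrite mulr0z.
- by rewrite IHe -sumrN; apply: eq_bigr => i _; rewrite mulrNz.
- by rewrite IH1 IH2 -big_split; apply: eq_bigr => i _; rewrite mulrzDr.
Qed.

Lemma zeval_eq (V : zmodType) (env : seq V) (e1 e2 : zexp) :
  all (fun i => zcoef e1 i == zcoef e2 i) (iota 0 (size env)) ->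
  zeval env e1 = zeval env e2.
Proof.
move=> /allP eq12; rewrite !zevalE; apply: eq_bigr => i _.
by rewrite (eqP (eq12 i _)) // mem_iota add0n ltn_ord.
Qed.

Ltac zindex t env :=
  match env with
  | ?h :: _ => let _ := match goal with _ => unify h t end in constr:(0%N)
  | _ :: ?env' => let n := zindex t env' in constr:(S n)
  end.
Ltac zatoms t env :=
  lazymatch t with
  | ?u + ?v => let env' := zatoms u env in zatoms v env'
  | - ?u => zatoms u env
  | 0 => env
  | _ => match env with
         | _ => let n := zindex t env in env
         | _ => constr:(t :: env)
         end
  end.
Ltac zreify t env :=
  lazymatch t with
  | ?u + ?v => let a := zreify u env in let b := zreify v env in
               constr:(ZAdd a b)
  | - ?u => let a := zreify u env in constr:(ZOpp a)
  | 0 => constr:(ZZero)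
  | _ => let n := zindex t env in constr:(ZVar n)
  end.
Ltac zmod :=
  lazymatch goal with
  | |- @eq ?V ?u ?v =>
    let env := zatoms u (@nil V) in
    let env := zatoms v env in
    let a := zreify u env in
    let b := zreify v env in
    apply: (@zeval_eq _ env a b); vm_compute; reflexivity
  end.
Ltac lmod :=
  rewrite ?(scalerBr, scalerDr, scalerN, scaler0, scalerBl, scalerDl, scaleNr,
            scale1r, scale0r, scalerA); zmod.

(* Proves [S u] from [h : S v] when u = v is an identity in the module. *)
Ltac mem h :=
  let g := fresh in
  have g := h;
  match type of g with ?S ?v => match goal with |- _ ?u =>
    have -> : u = v by lmod end end; exact: g.

(** * The lattice of stable subspaces *)

Definition stable (K : pzRingType) (W : lmodType K) (idx : Type)
    (act : idx -> W -> W) (S : W -> Prop) : Prop :=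
  [/\ S 0, forall r u v, S u -> S v -> S (r *: u + v)
    & forall i u, S u -> S (act i u)].

(* The elements of the geometry are the act-stable subspaces of [whole]. *)
Record opModule (K : comPzRingType) := OpModule {
  carrier :> lmodType K;
  opIdx : Type;
  opAct : opIdx -> carrier -> carrier;
  whole : carrier -> Prop;
  opAct_linear : forall i, linear (opAct i);
  whole_stable : stable opAct whole
}.

Record subspace (K : comPzRingType) (M : opModule K) := Subspace {
  mem_sub :> M -> Prop;
  sub_stable : stable (@opAct K M) mem_sub;
  sub_whole : forall w, mem_sub w -> whole w
}.

Section Lattice.
Variables (K : comPzRingType) (M : opModule K).
Local Notation X := (subspace M).
Implicit Types (x y z a b o : X) (u v w : M).

Lemma opActD i u v : opAct i (u + v) = opAct i u + opAct i v.
Proof. by rewrite -[u in LHS]scale1r opAct_linear scale1r. Qed.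

Lemma opActB i u v : opAct i (u - v) = opAct i u - opAct i v.
Proof. by rewrite addrC -scaleN1r opAct_linear scaleN1r addrC. Qed.

Lemma opAct0 i : opAct i (0 : M) = 0.
Proof. by rewrite -[0 in LHS](subrr 0) opActB subrr. Qed.

Lemma opActZ i r u : opAct i (r *: u) = r *: opAct i u.
Proof. by rewrite -[_ *: u]addr0 opAct_linear opAct0 addr0. Qed.

Lemma sub0 x : x 0. Proof. by case: (sub_stable x). Qed.

Lemma subZD x r u v : x u -> x v -> x (r *: u + v).
Proof. by case: (sub_stable x) => _ + _; apply. Qed.

Lemma subZ x r u : x u -> x (r *: u).
Proof. by move=> xu; rewrite -[_ *: _]addr0; apply: subZD xu (sub0 x). Qed.

Lemma subD x u v : x u -> x v -> x (u + v).
Proof. by move=> xu xv; rewrite -[u]scale1r; apply: subZD. Qed.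

Lemma subN x u : x u -> x (- u).
Proof. by move=> xu; rewrite -scaleN1r; apply: subZ. Qed.

Lemma subB x u v : x u -> x v -> x (u - v).
Proof. by move=> xu xv; apply: subD => //; apply: subN. Qed.

Lemma sub_act x i u : x u -> x (opAct i u).
Proof. by case: (sub_stable x) => _ _; apply. Qed.

Lemma subspaceP x y : (forall w, x w <-> y w) -> x = y.
Proof.
case: x y => [x sx wx] [y sy wy] /= exy.
have {}exy : x = y by apply/funext => w; apply/propext.
by subst y; congr Subspace; apply: Prop_irrelevance.
Qed.

HB.instance Definition _ := gen_eqMixin X.
HB.instance Definition _ := gen_choiceMixin X.

Definition subspace_le x y : bool := `[< forall w, x w -> y w >].

Fact subspace_le_refl : reflexive subspace_le.
Proof. by move=> x; apply/asboolP. Qed.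
Fact subspace_le_anti : antisymmetric subspace_le.
Proof.
move=> x y /andP[/asboolP xy /asboolP yx].
by apply: subspaceP => w; split; [apply: xy|apply: yx].
Qed.
Fact subspace_le_trans : transitive subspace_le.
Proof. by move=> y x z /asboolP xy /asboolP yz; apply/asboolP => w /xy /yz. Qed.

HB.instance Definition _ := Order.Le_isPOrder.Build (Order.Disp tt tt) X
  subspace_le_refl subspace_le_anti subspace_le_trans.

Lemma subspace_leP x y : reflect (forall w, x w -> y w) (x <= y)%O.
Proof. exact: asboolP. Qed.

Fact meet_stable x y : stable (@opAct K M) (fun w => x w /\ y w).
Proof.
split; first by split; apply: sub0.
- by move=> r u v [xu yu] [xv yv]; split; apply: subZD.
- by move=> i u [xu yu]; split; apply: sub_act.
Qed.
Definition subspace_meet x y : X :=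
  Subspace (meet_stable x y) (fun w h => sub_whole (proj1 h)).

Fact join_stable x y :
  stable (@opAct K M) (fun w => exists2 u, x u & y (w - u)).
Proof.
split; first by exists 0; rewrite ?subr0; apply: sub0.
- move=> r u v [u1 xu yu] [v1 xv yv]; exists (r *: u1 + v1); first exact: subZD.
  mem (subZD r yu yv).
- move=> i u [u1 xu yu]; exists (opAct i u1); first exact: sub_act.
  by rewrite -opActB; apply: sub_act.
Qed.
Definition subspace_top : X := Subspace (whole_stable M) (fun w h => h).

Fact join_whole x y w : (exists2 u, x u & y (w - u)) -> whole w.
Proof.
move=> [u /sub_whole xu /sub_whole yu].
mem (subD (x := subspace_top) xu yu).
Qed.
Definition subspace_join x y : X := Subspace (join_stable x y) (@join_whole x y).

Fact bot_stable : stable (@opAct K M) (fun w => w = 0).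
Proof.
split=> // [r u v -> ->|i u ->]; first by rewrite scaler0 addr0.
by rewrite opAct0.
Qed.
Fact bot_whole w : w = 0 -> whole w.
Proof. by move=> ->; apply: (sub0 subspace_top). Qed.
Definition subspace_bot : X := Subspace bot_stable bot_whole.

Fact subspace_meetP x y z : (x <= subspace_meet y z)%O = (x <= y)%O && (x <= z)%O.
Proof.
apply/subspace_leP/andP => [h|[/subspace_leP xy /subspace_leP xz]].
  by split; apply/subspace_leP => w /h [].
by move=> w xw; split; [apply: xy|apply: xz].
Qed.
Fact subspace_joinP x y z : (subspace_join x y <= z)%O = (x <= z)%O && (y <= z)%O.
Proof.
apply/subspace_leP/andP => [h|[/subspace_leP xz /subspace_leP yz]].
  split; apply/subspace_leP => w hw; apply: h.
    by exists w => //; rewrite subrr; apply: sub0.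
  by exists 0; [apply: sub0|rewrite subr0].
move=> w [u xu yu]; mem (subD (xz _ xu) (yz _ yu)).
Qed.
HB.instance Definition _ := Order.POrder_MeetJoin_isLattice.Build
  (Order.Disp tt tt) X subspace_meetP subspace_joinP.

Fact subspace_le0 x : (subspace_bot <= x)%O.
Proof. by apply/subspace_leP => w ->; apply: sub0. Qed.
Fact subspace_le1 x : (x <= subspace_top)%O.
Proof. by apply/subspace_leP => w; apply: sub_whole. Qed.
HB.instance Definition _ := Order.hasBottom.Build (Order.Disp tt tt) X subspace_le0.
HB.instance Definition _ := Order.hasTop.Build (Order.Disp tt tt) X subspace_le1.

(** The conjunct [whole w] makes the intersection of the empty family the top element. *)
Fact capS_stable (S : set X) :
  stable (@opAct K M) (fun w => whole w /\ forall x, S x -> x w).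
Proof.
split; first by split=> [|x _]; [exact: (sub0 subspace_top)|exact: sub0].
- move=> r u v [wu Su] [wv Sv]; split=> [|x Sx].
    exact: (subZD (x := subspace_top)).
  by apply: subZD; [apply: Su|apply: Sv].
- move=> i u [wu Su]; split=> [|x Sx]; first exact: (sub_act (x := subspace_top)).
  exact/sub_act/Su.
Qed.
Definition subspace_cap (S : set X) : X :=
  Subspace (capS_stable S) (fun w h => proj1 h).

Lemma subspace_complete : complete_lattice X.
Proof.
have cap_inf (S : set X) : infimums S (subspace_cap S).
  split=> [x Sx|y lbS]; first by apply/subspace_leP => w [_ ]; apply.
  apply/subspace_leP => w yw; split=> [|x /lbS/subspace_leP]; last exact.
  exact: sub_whole yw.
(* A supremum of [S] is the infimum of its upper bounds. *)
move=> S; split; last by exists (subspace_cap S).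
have [lb_cap glb_cap] := cap_inf (ubound S).
by exists (subspace_cap (ubound S)); split=> // x Sx; apply: glb_cap => y; apply.
Qed.

Lemma complementP x y : reflect
  ((forall w, x w -> y w -> w = 0) /\
   (forall w, whole w -> exists2 u, x u & y (w - u))) (transversal_pair x y).
Proof.
apply: (iffP andP) => [[/eqP xy0 /eqP xy1]|[xy0 xy1]]; split.
- move=> w xw yw; have : (x `&` y)%O w by [].
  by rewrite xy0.
- by move=> w; rewrite -[whole w]/((\top%O : X) w) -xy1.
- apply/eqP/subspaceP => w; split=> [[]|->]; first exact: xy0.
  exact: (sub0 (x `&` y)%O).
- by apply/eqP/subspaceP => w; split=> [/sub_whole|/xy1].
Qed.

Lemma transversal_meet x y w : transversal_pair x y -> x w -> y w -> w = 0.
Proof. by case/complementP => xy0 _; apply: xy0. Qed.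

Lemma transversal_join x y w :
  transversal_pair x y -> whole w -> exists2 u, x u & y (w - u).
Proof. by case/complementP => _; apply. Qed.

(** The modular law: an element of [y] splits along [x] and [a], and its component in [a] lies in
    both [y] and [a], hence vanishes. *)
Lemma complement_eq a x y : transversal_pair x a -> transversal_pair y a ->
  (forall w, x w -> y w) -> x = y.
Proof.
move=> xa ya xy; apply: subspaceP => w; split=> [/xy //|yw].
have [u xu au] := transversal_join xa (sub_whole yw).
have /eqP := transversal_meet ya (subB yw (xy _ xu)) au.
by rewrite subr_eq0 => /eqP ->.
Qed.

End Lattice.

(** * The associative geometry of stable subspaces *)

Section Geometry.
Variables (K : comPzRingType) (M : opModule K).
Local Notation X := (subspace M).
Implicit Types (x y z a b o : X) (u v w : M).

(* w = ze + al = al + eta + be = xi + be with xi in x, eta in y, ze in z. *)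
Definition Gam_mem x a y b z w : Prop := exists al be,
  [/\ a al, b be, x (w - be), y (w - al - be) & z (w - al)].

Fact Gam_stable x a y b z : stable (@opAct K M) (Gam_mem x a y b z).
Proof.
split; first by exists 0, 0; rewrite !subr0; split; apply: sub0.
- move=> r u v [al [be [? ? h1 h2 h3]]] [al' [be' [? ? h1' h2' h3']]].
  exists (r *: al + al'), (r *: be + be'); split; try exact: subZD.
  + mem (subZD r h1 h1').
  + mem (subZD r h2 h2').
  + mem (subZD r h3 h3').
- move=> i u [al [be [? ? h1 h2 h3]]]; exists (opAct i al), (opAct i be).
  by rewrite -!opActB; split; apply: sub_act.
Qed.
Fact Gam_whole x a y b z w : Gam_mem x a y b z w -> whole w.
Proof.
move=> [al [be [_ /sub_whole hb /sub_whole h _ _]]].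
mem (subD (x := subspace_top M) h hb).
Qed.
Definition sGam x a y b z : X :=
  Subspace (Gam_stable x a y b z) (@Gam_whole x a y b z).

(* The set of all (1 - r) xi + r eta with xi in x, eta in y, eta - xi in a. *)
Definition Dil_mem (r : K) x a y w : Prop := exists xi ga,
  [/\ x xi, a ga, y (xi + ga) & w = xi + r *: ga].

Fact Dil_stable r x a y : stable (@opAct K M) (Dil_mem r x a y).
Proof.
split; first by exists 0, 0; rewrite scaler0 !addr0; split=> //; apply: sub0.
- move=> s u v [xi [ga [? ? h ->]]] [xi' [ga' [? ? h' ->]]].
  exists (s *: xi + xi'), (s *: ga + ga'); split; try exact: subZD.
    mem (subZD s h h').
  have {1}-> : r *: (s *: ga + ga') = s *: (r *: ga) + r *: ga'.
    by rewrite scalerDr !scalerA mulrC.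
  by rewrite scalerDr; zmod.
- move=> i u [xi [ga [? ? h ->]]]; exists (opAct i xi), (opAct i ga).
  by rewrite -opActD -opActZ -opActD; split=> //; apply: sub_act.
Qed.
Fact Dil_whole r x a y w : Dil_mem r x a y w -> whole w.
Proof.
move=> [xi [ga [/sub_whole hx /sub_whole ha _ ->]]].
mem (subD (x := subspace_top M) hx (subZ (x := subspace_top M) r ha)).
Qed.
Definition sDil r x a y : X := Subspace (@Dil_stable r x a y) (@Dil_whole r x a y).

(** Unfolded, both sides ask for two elements of [a] and two of [b] subject to the same five
    memberships; only the grouping of these elements changes. *)
Lemma sGamA x y z (u v : X) a b :
  sGam (sGam x a y b z) a u b v = sGam x a y b (sGam z a u b v).
Proof.
apply: subspaceP => w; split.
- move=> [al [be [aal bbe [al' [be' [aal' bbe' h1 h2 h3]]] h4 h5]]].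
  exists al', (be + be'); split=> //; first exact: subD.
  + mem h1.
  + mem h2.
  + exists (al - al'), be; split=> //; first exact: subB.
    * mem h3.
    * mem h4.
    * mem h5.
- move=> [al' [be' [aal' bbe' h1 h2 [al [be [aal bbe h3 h4 h5]]]]]].
  exists (al + al'), be; split=> //; first exact: subD.
  + exists al', (be' - be); split=> //; first exact: subB.
    * mem h1.
    * mem h2.
    * mem h3.
  + mem h4.
  + mem h5.
Qed.

(** Again a regrouping of five memberships; the inner product on the right is taken at w - al - be -
    be', which turns be' into its negative. *)
Lemma sGamAC x y z (u v : X) a b :
  sGam (sGam x a y b z) a u b v = sGam x a (sGam u a z b y) b v.
Proof.
apply: subspaceP => w; split.
- move=> [al [be [aal bbe [al' [be' [aal' bbe' h1 h2 h3]]] h4 h5]]].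
  exists al, (be + be'); split=> //; first exact: subD.
  + mem h1.
  + exists (al' - al), (- be'); split; [exact: subB|exact: subN|..].
    * mem h4.
    * mem h3.
    * mem h2.
- move=> [al [be [aal bbe h1 [al' [be' [aal' bbe' h2 h3 h4]]] h5]]].
  exists al, (be + be'); split=> //; first exact: subD.
  + exists (al + al'), (- be'); split; [exact: subD|exact: subN|..].
    * mem h1.
    * mem h4.
    * mem h3.
  + mem h2.
Qed.

Lemma sGam_rev x a y b z : sGam x a y b z = sGam z b y a x.
Proof.
apply: subspaceP => w; split=> -[al [be [? ? ? h ?]]]; exists be, al; split=> //.
- mem h.
- mem h.
Qed.

Lemma sGam_swap x a y b z : sGam x a y b z = sGam a x y z b.
Proof.
have swap x' a' y' b' z' w : sGam x' a' y' b' z' w -> sGam a' x' y' z' b' w.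
  (* xi = w - be and ze = w - al exchange roles with be and al, and the component in y' changes
     sign. *)
  move=> [al [be [aal bbe h1 h2 h3]]]; exists (w - be), (w - al); split=> //.
  - mem aal.
  - mem (subN h2).
  - mem bbe.
by apply: subspaceP => w; split; apply: swap.
Qed.

(* All the maps of axiom (3) are images under a linear relation g, paired with
   the images under the inverse relation. *)
Lemma relation_morph (g : M -> M -> Prop) (G H : X -> X) :
  (forall r u u' v v', g u u' -> g v v' -> g (r *: u + v) (r *: u' + v')) ->
  (forall z w, G z w <-> exists2 u, z u & g u w) ->
  (forall z w, H z w <-> exists2 u, z u & g w u) ->
  struct_morph sGam sDil sGam sDil G H.
Proof.
move=> gL GE HE.
have gD u u' v v' : g u u' -> g v v' -> g (u + v) (u' + v').
  by move=> h1 h2; have := gL 1 _ _ _ _ h1 h2; rewrite !scale1r.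
have gB u u' v v' : g u u' -> g v v' -> g (u - v) (u' - v').
  move=> h1 h2; have := gL (-1) _ _ _ _ h2 h1.
  by rewrite !scaleN1r [- v + u]addrC [- v' + u']addrC.
have gE u u' v v' : g u u' -> u = v -> u' = v' -> g v v' by move=> ? <- <-.
split=> [x c y d z|r x c y]; apply: subspaceP => w; rewrite GE; split.
- move=> [u [al [be [/HE [al' cal gal] /HE [be' dbe gbe] h1 h2 h3]]] guw].
  exists al', be'; split=> //; apply/GE.
  + by exists (u - be) => //; apply: gB.
  + by exists (u - al - be) => //; apply: (gB) => //; apply: gB.
  + by exists (u - al) => //; apply: gB.
- move=> [al [be [cal dbe /GE[x1 xx1 g1] /GE[y1 yy1 g2] /GE[z1 zz1 g3]]]].
  (* Since w = xi + ze - eta, al = xi - eta and be = ze - eta, the preimages of xi, eta, ze yield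
     those of w, al and be. *)
  exists (x1 + z1 - y1); last first.
    by apply: (gE _ _ _ _ (gB _ _ _ _ (gD _ _ _ _ g1 g3) g2)); zmod.
  exists (x1 - y1), (z1 - y1); split.
  + by apply/HE; exists al => //; apply: (gE _ _ _ _ (gB _ _ _ _ g1 g2)); zmod.
  + by apply/HE; exists be => //; apply: (gE _ _ _ _ (gB _ _ _ _ g3 g2)); zmod.
  + mem xx1.
  + mem yy1.
  + mem zz1.
- move=> [u [xi [ga [xxi /HE [ga' cga gga] h ->]]] guw].
  have gxi : g xi (w - r *: ga').
    by apply: (gE _ _ _ _ (gL (- r) _ _ _ _ gga guw)); lmod.
  exists (w - r *: ga'), ga'; split=> //; last by zmod.
    by apply/GE; exists xi.
  by apply/GE; exists (xi + ga) => //; apply: gD.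
- move=> [xi [ga [/GE[x1 xx1 g1] cga /GE[y1 yy1 g2] ->]]].
  have gga : g (y1 - x1) ga by apply: (gE _ _ _ _ (gB _ _ _ _ g2 g1)); zmod.
  exists (x1 + r *: (y1 - x1)); last first.
    by apply: (gE _ _ _ _ (gL r _ _ _ _ gga g1)); zmod.
  exists x1, (y1 - x1); split=> //; first by apply/HE; exists ga.
  mem yy1.
Qed.

Lemma relation_structural (g : M -> M -> Prop) (G H : X -> X) :
  (forall r u u' v v', g u u' -> g v v' -> g (r *: u + v) (r *: u' + v')) ->
  (forall z w, G z w <-> exists2 u, z u & g u w) ->
  (forall z w, H z w <-> exists2 u, z u & g w u) ->
  structural sGam sDil sGam sDil G H.
Proof.
move=> gL GE HE; split; first exact: relation_morph gL GE HE.
by apply: (relation_morph (g := fun u v => g v u)) => // r u u' v v'; apply: gL.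
Qed.

(** The relation links u in z to w = u + al. As [a] is closed under negation, inverting it only
    exchanges [x] and [y]. *)
Lemma sGam_structL x a y b : structural sGam sDil sGam sDil
  (fun z => sGam x a y b z) (fun z => sGam y a x b z).
Proof.
apply: (relation_structural (g := fun u w =>
    a (w - u) /\ exists2 be, b be & x (w - be) /\ y (u - be))).
- move=> r u u' v v' [a1 [b1 bb1 [x1 y1]]] [a2 [b2 bb2 [x2 y2]]].
  split; first by mem (subZD r a1 a2).
  exists (r *: b1 + b2); [exact: subZD|split].
    mem (subZD r x1 x2).
  mem (subZD r y1 y2).
- move=> z w; split=> [[al [be [aal bbe h1 h2 h3]]]|[u zu [a1 [be bbe [h1 h2]]]]].
    exists (w - al) => //; split; first by mem aal.
    by exists be.
  exists (w - u), be; split=> //.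
  + mem h2.
  + mem zu.
- move=> z w; split=> [[al [be [aal bbe h1 h2 h3]]]|[u zu [a1 [be bbe [h1 h2]]]]].
    exists (w - al) => //; split; first by mem (subN aal).
    by exists be.
  exists (w - u), be; split=> //.
  + mem (subN a1).
  + mem h1.
  + mem zu.
Qed.

Lemma sGam_structR a y b z : structural sGam sDil sGam sDil
  (fun x => sGam x a y b z) (fun x => sGam x a z b y).
Proof.
have := sGam_structL z b y a.
by congr structural; apply/funext => x; apply: sGam_rev.
Qed.

(** Solving u = w - al - be for w negates al and be, so the inverse relation is the same one with
    [x] and [z] exchanged. *)
Lemma sGam_structM x a b z : structural sGam sDil sGam sDil
  (fun y => sGam x a y b z) (fun y => sGam z a y b x).
Proof.
apply: (relation_structural (g := fun u w => exists al be,
    [/\ a al, b be, x (w - be), z (w - al) & u = w - al - be])).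
- move=> r u u' v v' [a1 [b1 [ha hb hx hz ->]]] [a2 [b2 [ha' hb' hx' hz' ->]]].
  exists (r *: a1 + a2), (r *: b1 + b2); split; try exact: subZD.
  + mem (subZD r hx hx').
  + mem (subZD r hz hz').
  + lmod.
- move=> y w; split=> [[al [be [aal bbe h1 h2 h3]]]|].
    by exists (w - al - be) => //; exists al, be.
  by move=> [u yu [al [be [aal bbe h1 h2 eu]]]]; exists al, be; rewrite -eu.
- move=> y w; split=> [[al [be [aal bbe h1 h2 h3]]]|].
    exists (w - al - be) => //; exists (- al), (- be).
    split; [exact: subN|exact: subN|..|zmod].
    + mem h3.
    + mem h1.
  move=> [u yu [al [be [aal bbe h1 h2 ->]]]].
  exists (- al), (- be); split; [exact: subN|exact: subN|..].
  + mem h2.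
  + mem yu.
  + mem h1.
Qed.

Lemma sGam_join a b y : sGam a a y b b = (a `|` b)%O.
Proof.
apply: subspaceP => w; split=> [[al [be [aal bbe h1 h2 h3]]]|[u au bwu]].
  by exists al.
exists u, (w - u); split=> //.
- mem au.
- mem (sub0 y).
Qed.

Lemma sGam_meet a b y : sGam a b y a b = (a `&` b)%O.
Proof.
apply: subspaceP => w; split=> [[al [be [aal bbe h1 h2 h3]]]|[aw bw]].
  by split; [mem (subD h1 bbe)|mem (subD h3 aal)].
exists 0, w; split=> //; [exact: sub0|..].
- mem (sub0 a).
- mem (sub0 y).
- mem bw.
Qed.

Lemma sGam_unitl x a b z : x \in Cset a -> x \in Cset b -> sGam x a x b z = z.
Proof.
move=> xa xb; apply: subspaceP => w; split.
  move=> [al [be [aal bbe h1 h2 h3]]].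
  have al0 : al = 0 by apply: transversal_meet xa _ aal; mem (subB h1 h2).
  by move: h3; rewrite al0 subr0.
move=> zw; have [u xu bu] := transversal_join xb (sub_whole zw).
exists 0, (w - u); split=> //; first exact: sub0.
- mem xu.
- mem xu.
- mem zw.
Qed.

Lemma sGam_unitr x a b z : x \in Cset a -> x \in Cset b -> sGam z b x a x = z.
Proof. by move=> xa xb; rewrite sGam_rev; apply: sGam_unitl. Qed.

Lemma sGam_absb x a y b :
  transversal_pair a x -> transversal_pair y b -> sGam x a y b b = b.
Proof.
move=> ax yb; apply: subspaceP => w; split.
  move=> [al [be [aal bbe h1 h2 h3]]].
  have h4 : w - al - be = 0 by apply: transversal_meet yb h2 (subB h3 bbe).
  have al0 : al = 0.
    apply: transversal_meet ax aal _.
    have -> : al = w - be - (w - al - be) by zmod.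
    by rewrite h4 subr0.
  by rewrite al0 subr0 in h3.
move=> bw; exists 0, w; split=> //; first exact: sub0.
- mem (sub0 x).
- mem (sub0 y).
- mem bw.
Qed.

Lemma sGam_absa x a y b :
  transversal_pair a y -> transversal_pair b x -> sGam x a y b a = a.
Proof.
move=> ay bx; apply: subspaceP => w; split.
  by move=> [al [be [aal bbe h1 h2 h3]]]; mem (subD h3 aal).
move=> aw; have [be bbe xi] := transversal_join bx (sub_whole aw).
have [al aal eta] := transversal_join ay (sub_whole xi).
exists al, be; split=> //; last exact: subB.
mem eta.
Qed.

Lemma sGam_aba a b x y z :
  x \in Cset a -> y \in Cset b -> z \in Cset a -> sGam x a y b z \in Cset a.
Proof.
move=> xa yb za; apply/complementP; split=> [w [al [be [aal bbe h1 h2 h3]]] aw|t Tt].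
  (* The components vanish in turn: ze lies in z and a, then be in y and b, finally w = xi in x and
     a. *)
  have e1 : w - al = 0 by apply: transversal_meet za h3 _; apply: subB.
  have be0 : be = 0.
    by apply: transversal_meet yb _ bbe; move/subN: h2; rewrite e1 sub0r opprK.
  by move: h1; rewrite be0 subr0 => xw; apply: transversal_meet xa xw aw.
(* t agrees with ze modulo a, ze with eta modulo b, and eta with xi modulo a; then ze - eta + xi
   lies in the product and agrees with t modulo a. *)
have [ze zze aze] := transversal_join za Tt.
have [eta yeta bbe] := transversal_join yb (sub_whole zze).
have [xi xxi aal] := transversal_join xa (sub_whole yeta).
exists (ze - (eta - xi)); last by mem (subD aze aal).
exists (- (eta - xi)), (ze - eta); split=> //; first exact: subN.
- mem xxi.
- mem yeta.
- mem zze.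
Qed.

Lemma sGam_bab a b x y z :
  x \in Cset b -> y \in Cset a -> z \in Cset b -> sGam x a y b z \in Cset b.
Proof. by move=> xb ya zb; rewrite sGam_rev; apply: sGam_aba. Qed.

(** * The affine space of complements of a fixed subspace *)

Section Affine.
Variable a : X.

Lemma stor_closed x y z :
  x \in Cset a -> y \in Cset a -> z \in Cset a -> sGam x a y a z \in Cset a.
Proof. exact: sGam_aba. Qed.

Lemma sdil_closed r x y : x \in Cset a -> y \in Cset a -> sDil r x a y \in Cset a.
Proof.
move=> xa ya; apply/complementP; split=> [w [xi [ga [xxi aga h ->]]] aw|t Tt].
  have xi0 : xi = 0.
    by apply: transversal_meet xa xxi _; mem (subB aw (subZ r aga)).
  have ga0 : ga = 0.
    by apply: transversal_meet ya _ aga; move: h; rewrite xi0 add0r.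
  by rewrite xi0 ga0 scaler0 addr0.
have [xi xxi axi] := transversal_join xa Tt.
have [eta yeta aeta] := transversal_join ya Tt.
have aga : a (eta - xi) by mem (subB axi aeta).
exists (xi + r *: (eta - xi)); last by mem (subB axi (subZ r aga)).
exists xi, (eta - xi); split=> //; mem yeta.
Qed.

Lemma storK x y : x \in Cset a -> y \in Cset a -> sGam x a y a y = x.
Proof.
move=> xa ya; apply: (complement_eq (a := a)) => //; first exact: stor_closed.
move=> w [al [be [aal abe h1 h2 h3]]].
have be0 : be = 0 by apply: transversal_meet ya _ abe; mem (subB h3 h2).
by move: h1; rewrite be0 subr0.
Qed.

Lemma sdil1 o x : o \in Cset a -> x \in Cset a -> sDil 1 o a x = x.
Proof.
move=> oa xa; apply: (complement_eq (a := a)) => //; first exact: sdil_closed.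
by move=> w [xi [ga [_ _ h ->]]]; rewrite scale1r.
Qed.

Lemma sdilA r s o x : o \in Cset a -> x \in Cset a ->
  sDil r o a (sDil s o a x) = sDil (r * s) o a x.
Proof.
move=> oa xa; apply: (complement_eq (a := a)); try by do ?[apply: sdil_closed].
move=> w [o1 [ga [oo1 aga [o2 [de [oo2 ade h e]]] ->]]].
(* Components along [o] and [a] are unique, so the two decompositions of o1 + ga coincide. *)
have e0 : o1 - o2 = 0.
  apply: transversal_meet oa (subB oo1 oo2) _.
  have -> : o1 - o2 = (o1 + ga) - o2 - ga by zmod.
  by rewrite e; mem (subB (subZ s ade) aga).
have eo : o1 = o2 by apply/eqP; rewrite -subr_eq0 e0.
subst o2; have {}e : ga = s *: de by apply: (addrI o1).
by exists o1, de; rewrite e scalerA; split.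
Qed.

Lemma sdilDr r o x y : o \in Cset a -> x \in Cset a -> y \in Cset a ->
  sDil r o a (sGam x a o a y) = sGam (sDil r o a x) a o a (sDil r o a y).
Proof.
move=> oa xa ya; apply: (complement_eq (a := a)).
- by apply: sdil_closed => //; apply: stor_closed.
- by apply: stor_closed => //; apply: sdil_closed.
move=> w [o1 [ga [oo1 aga [al [be [aal abe h1 h2 h3]]] ->]]].
(* Both o1 and the middle component o1 + ga - al - be lie in [o], and their difference lies in
   [a]. *)
have /eqP : ga - al - be = 0.
  apply: transversal_meet oa _ (subB (subB aga aal) abe).
  mem (subB h2 oo1).
rewrite -addrA -opprD subr_eq0 => /eqP ega; rewrite {}ega in aga h1 h2 h3 *.
exists (r *: al), (r *: be); split; try exact: subZ.
- exists o1, al; split=> //; last lmod.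
  mem h1.
- mem oo1.
- exists o1, be; split=> //; last lmod.
  mem h3.
Qed.

Lemma sdilDl r s o x : o \in Cset a -> x \in Cset a ->
  sDil (r + s) o a x = sGam (sDil r o a x) a o a (sDil s o a x).
Proof.
move=> oa xa; apply: (complement_eq (a := a)).
- exact: sdil_closed.
- by apply: stor_closed => //; apply: sdil_closed.
move=> w [o1 [ga [oo1 aga h ->]]].
exists (r *: ga), (s *: ga); split; try exact: subZ.
- by exists o1, ga; split=> //; lmod.
- mem oo1.
- by exists o1, ga; split=> //; lmod.
Qed.

Lemma sdilE r o x y : o \in Cset a -> x \in Cset a -> y \in Cset a ->
  sDil r x a y = sGam (sDil (1 - r) o a x) a o a (sDil r o a y).
Proof.
move=> oa xa ya; apply: (complement_eq (a := a)).
- exact: sdil_closed.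
- by apply: stor_closed => //; apply: sdil_closed.
move=> w [xi [ga [xxi aga h ->]]].
(* xi and eta = xi + ga differ by an element of [a], so they share the component o1 in [o]; the
   witnesses are their multiples relative to this origin. *)
have [o1 oo1 ade] := transversal_join oa (sub_whole xxi).
have aep : a (xi + ga - o1) by mem (subD ade aga).
exists ((1 - r) *: (xi - o1)), (r *: (xi + ga - o1)); split; try exact: subZ.
- exists o1, (xi - o1); split=> //; last lmod.
  mem xxi.
- mem oo1.
- exists o1, (xi + ga - o1); split=> //; last lmod.
  mem h.
Qed.

Lemma subspace_affine : affine_space (Cset a)
  (fun x y z => sGam x a y a z) (fun r x y => sDil r x a y).
Proof.
split.
- exact: stor_closed.
- exact: sdil_closed.
- exact: storK.
- by move=> x y z _ _ _; apply: sGam_rev.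
- by move=> x y z u v _ _ _ _ _; apply: sGamA.
- exact: sdil1.
- exact: sdilA.
- exact: sdilDr.
- exact: sdilDl.
- exact: sdilE.
Qed.

End Affine.

HB.instance Definition _ := isAssocGeometry.Build K (Order.Disp tt tt) X
  (@subspace_complete K M) sGamA sGamAC sGam_rev sGam_swap sGam_structL
  sGam_structM sGam_structR sGam_join sGam_meet sGam_unitl sGam_unitr sGam_absb
  sGam_absa subspace_affine sGam_aba sGam_bab.

End Geometry.

(** * Complements as graphs *)

Section Generated.
Variables (K : pzRingType) (W : lmodType K) (idx : Type) (act : idx -> W -> W).

(** The generated stable subspace, defined impredicatively: a property of its elements follows from
    any stable predicate that holds at [s]. *)
Definition gen (s w : W) : Prop := forall S, stable act S -> S s -> S w.

Lemma gen_stable s : stable act (gen s).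
Proof.
split; first by move=> S [].
- by move=> r u v gu gv S stS Ss; case: (stS) => _ + _; apply; [apply: gu|apply: gv].
- by move=> i u gu S stS Ss; case: (stS) => _ _; apply; apply: gu.
Qed.

Lemma gen_id s : gen s s. Proof. by []. Qed.

End Generated.

Lemma linear_pack (K : pzRingType) (U V : lmodType K) (f : U -> V) :
  linear f -> exists F : {linear U -> V}, F =1 f.
Proof.
move=> fL; pose fI := GRing.isLinear.Build K U V *:%R f fL.
by exists (HB.pack_for {linear U -> V} f fI).
Qed.

Section Complements.
Variables (K : comPzRingType) (M : opModule K) (A : lmodType K).
Variables (op om : subspace M) (e : M) (iota : A -> M) (p : opIdx M).
Local Notation act := (@opAct K M).
Hypothesis iotaL : linear iota.
Hypothesis iotaI : injective iota.
Hypothesis op_e : op e.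
Hypothesis op_gen : forall w, op w -> gen act e w.
Hypothesis om_iota : forall a, om (iota a).
(** [p] is a projection used to normalise an element e - n of a complement, with n in [om]: its
    image is e minus an element of the image of [iota]. It is the unit for algebras and a Peirce
    projection for pairs. *)
Hypothesis p_e : act p e = e.
Hypothesis p_om : forall n, om n -> exists a, act p n = iota a.
Hypothesis op_join : forall w, whole w -> exists2 u, op u & om (w - u).
Hypothesis graph_disj : forall a w, gen act (e + iota a) w -> om w -> w = 0.

Let iota0 : iota 0 = 0.
Proof.
have := iotaL 1 0 0; rewrite !scale1r addr0 => h.
by apply: (addrI (iota 0)); rewrite -h addr0.
Qed.

Let iotaN a : iota (- a) = - iota a.
Proof. by have := iotaL (-1) a 0; rewrite !scaleN1r iota0 !addr0. Qed.

Fact graph_whole a w : gen act (e + iota a) w -> whole w.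
Proof.
move=> h; apply: h; first exact: whole_stable.
exact: (subD (x := subspace_top M) (sub_whole op_e) (sub_whole (om_iota a))).
Qed.

(** The graph of the map from [op] to [om] that commutes with the operators and sends [e] to
    [iota a]. *)
Definition graph a : subspace M :=
  Subspace (gen_stable act (e + iota a)) (@graph_whole a).

Lemma graph_min a (x : subspace M) : x (e + iota a) -> forall w, graph a w -> x w.
Proof. by move=> xea w; apply=> //; apply: sub_stable. Qed.

Lemma graph_trans a : graph a \in Cset om.
Proof.
apply/complementP; split=> [|w /op_join [u op_u om_wu]]; first exact: graph_disj.
(* [op] lies in the join as soon as its generator does, and e = (e + iota a) - iota a. *)
suff /subspace_leP/(_ u op_u) [v gv om_uv] : (op <= graph a `|` om)%O.
  by exists v => //; mem (subD om_uv om_wu).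
apply/subspace_leP => {w om_wu}w /op_gen; apply; first exact: sub_stable.
exists (e + iota a); first exact: gen_id.
mem (subN (om_iota a)).
Qed.

Lemma graph_eq a (x : subspace M) : x \in Cset om -> x (e + iota a) -> graph a = x.
Proof. by move=> tx xea; apply: complement_eq (graph_trans a) tx (graph_min xea). Qed.

Lemma graph_inj : injective graph.
Proof.
move=> a b eab; apply: iotaI; apply/eqP; rewrite -subr_eq0; apply/eqP.
have gb : graph b (e + iota b) by apply: gen_id.
have ga : graph b (e + iota a) by rewrite -eab; apply: gen_id.
apply: transversal_meet (graph_trans b) _ (subB (om_iota a) (om_iota b)).
mem (subB ga gb).
Qed.

Lemma graph_surj (x : subspace M) : x \in Cset om -> exists a, graph a = x.
Proof.
(* Split e = u + n along [x] and [om]; then p u = e - p n lies in [x], whence the sign in the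
   witness - a. *)
move=> tx; have [u xu om_eu] := transversal_join tx (sub_whole op_e).
have [a pa] := p_om om_eu.
exists (- a); apply: graph_eq => //.
have -> : e + iota (- a) = act p u.
  rewrite iotaN -pa opActB p_e; zmod.
exact: sub_act.
Qed.

(** The last clause is the tool for computing products: a complement is recognised as F a from the
    single element e + iota a. *)
Lemma complement_iso (o : {x : subspace M | x \in Cset om}) : sval o = op ->
  exists F : {linear A -> affmod o},
    [/\ bijective F, forall a, sval (F a) (e + iota a)
      & forall a (x : affmod o), sval x (e + iota a) -> F a = x].
Proof.
move=> eo; pose f a : affmod o := exist _ (graph a) (graph_trans a).
have fP a (x : affmod o) : sval x (e + iota a) -> f a = x.
  by move=> xea; apply: val_inj; apply: graph_eq => //; apply: (svalP x).
have fin a : sval (f a) (e + iota a) by apply: gen_id.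
have fL : linear f.
  (* Only e + r iota a + iota b has to be found in the affine combination; its middle component is
     [e]. *)
  move=> r a b; apply: fP; rewrite iotaL.
  exists (r *: iota a), (iota b); rewrite /= eo; split=> //.
  - exact: subZ.
  - exists e, (iota a); split=> //.
    zmod.
  - mem op_e.
  - have -> : e + (r *: iota a + iota b) - r *: iota a = e + iota b by zmod.
    exact: gen_id.
have [F FE] := linear_pack fL; exists F; split=> [|a|a x]; try by rewrite FE.
- have fI : injective f by move=> a b /(congr1 sval) /graph_inj.
  have /choice[g fK] (x : affmod o) : exists a, f a = x.
    by have [a ga] := graph_surj (svalP x); exists a; apply: val_inj.
  by apply: (eq_bij _ (fsym FE)); exists g => //; apply: inj_can_sym.
- by rewrite FE => /fP.
Qed.

End Complements.

(** * Unital algebras *)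

Section Algebra.
Variables (K : comPzRingType) (A : unitalAlg K).
Local Notation W := (A * A)%type.
Local Notation "x ** y" := (@alg_mul K A x y) (at level 40, left associativity).

Definition alg_act (a : A) (w : W) : W := (a ** w.1, a ** w.2).

Fact alg_act_linear a : linear (alg_act a).
Proof. by move=> r u v; rewrite /alg_act /= !alg_mul_linearr. Qed.

Fact alg_whole_stable : stable alg_act (fun=> True). Proof. by []. Qed.

Definition alg_module : opModule K := OpModule alg_act_linear alg_whole_stable.

Let mul0 a : 0 ** a = 0.
Proof.
have := alg_mul_linearl a 1 0 0; rewrite !scale1r addr0 => h.
by apply: (addrI (0 ** a)); rewrite -h addr0.
Qed.
Let mula0 a : a ** 0 = 0.
Proof.
have := alg_mul_linearr a 1 0 0; rewrite !scale1r addr0 => h.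
by apply: (addrI (a ** 0)); rewrite -h addr0.
Qed.

Fact alg_op_stable : stable alg_act (fun w : W => w.2 = 0).
Proof.
split=> // [r u v /= -> ->|a u /= ->]; last exact: mula0.
by rewrite scaler0 addr0.
Qed.
Fact alg_om_stable : stable alg_act (fun w : W => w.1 = 0).
Proof.
split=> // [r u v /= -> ->|a u /= ->]; last exact: mula0.
by rewrite scaler0 addr0.
Qed.
Fact alg_delta_stable : stable alg_act (fun w : W => w.1 = w.2).
Proof. by split=> // [r u v /= -> ->|a u /= ->]. Qed.

Definition alg_op : subspace alg_module :=
  @Subspace K alg_module _ alg_op_stable (fun _ _ => I).
Definition alg_om : subspace alg_module :=
  @Subspace K alg_module _ alg_om_stable (fun _ _ => I).
Definition alg_delta : subspace alg_module :=
  @Subspace K alg_module _ alg_delta_stable (fun _ _ => I).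

Lemma alg_triple : transversal_triple alg_op alg_delta alg_om.
Proof.
apply/and3P; split; apply/complementP; split; move=> [u v] /=.
- by move=> -> ->.
- by move=> _; exists (u - v, 0) => //=; rewrite subr0 subKr.
- by move=> -> ->.
- by move=> _; exists (u, u) => //=; rewrite subrr.
- by move=> -> ->.
- by move=> _; exists (u, 0) => //=; rewrite subrr.
Qed.

Lemma alg_geometry :
  exists (d : Order.disp_t) (X : assocGeometryType K d) (op Delta om : X)
    (tr : transversal_triple op Delta om),
    alg_isomorphic A (associated_algebra tr).
Proof.
exists (Order.Disp tt tt), (subspace alg_module), alg_op, alg_delta, alg_om.
exists alg_triple.
pose e : alg_module := (alg_one A, 0); pose iota (a : A) : alg_module := (0, a).
have [||||||||| F [bF Fin FP]] := @complement_iso K alg_module A alg_op alg_om e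
  iota (alg_one A) _ _ _ _ _ _ _ _ _ (origin_alg alg_triple) erefl.
- by move=> r a b; congr pair => /=; rewrite scaler0 addr0.
- by move=> a b [].
- by [].
- move=> [u v] /= -> S stS Se.
  have -> : (u, 0) = alg_act u e by rewrite /alg_act /= alg_mul1 mula0.
  by case: stS => _ _; apply.
- by [].
- by congr pair => /=; rewrite ?alg_mul1 ?mula0.
- by move=> [u v] /= ->; exists v; rewrite /alg_act /= mula0 alg_1mul.
- by move=> [u v] _; exists (u, 0) => //=; rewrite subrr.
(* The left submodule generated by (1, a) lies in the graph of right multiplication by [a]. *)
- move=> a w gw /= w0; have : w.2 = w.1 ** a.
    apply: (gw (fun u : W => u.2 = u.1 ** a)); last first.
      by rewrite /= add0r addr0 alg_1mul.
    split; first by rewrite mul0.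
      by move=> r u v /= -> ->; rewrite alg_mul_linearl.
    by move=> b u /= ->; rewrite alg_mulA.
  by rewrite w0 mul0; case: w w0 {gw} => /= w1 w2 -> ->.
exists F; split=> // [x z|]; last by apply: FP; rewrite /= addr0 add0r.
(* For w = (1, xz) the three components are (1, x), (x, x) on the diagonal, and (x, xz), which is x
   acting on (1, z). *)
apply: FP; exists (alg_one A - x, 0), (0, x ** z - x); split=> //=.
- have := Fin x; congr (sval (F x) _); congr pair => /=; first by rewrite subr0 addr0.
  by rewrite !add0r subKr.
- by rewrite !addr0 !add0r !subr0 !subKr.
- have -> : e + iota (x ** z) - (alg_one A - x, 0) = alg_act x (e + iota z).
    congr pair => /=; first by rewrite !addr0 alg_mul1 subKr.
    by rewrite !add0r subr0.
  by apply: (sub_act (M := alg_module)); apply: Fin.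
Qed.

End Algebra.

(** * Associative pairs *)

(* The step common to both products: o1 and o2 are generated by e1 and e2, and
   the elements of V and U act as operators interchanging them. *)
Lemma Gam_triple (K : comPzRingType) (M : opModule K) (U V : Type)
    (o1 o2 : subspace M) (e1 e2 : M) (i1 : U -> M) (i2 : V -> M)
    (jU : U -> opIdx M) (jV : V -> opIdx M) (t : U -> V -> U -> U) :
  o1 e1 -> (forall b, o1 (i2 b)) -> (forall x, o2 (i1 x)) ->
  (forall b, opAct (jV b) e1 = i2 b) -> (forall z, opAct (jU z) e2 = i1 z) ->
  (forall x b z, opAct (jU z) (opAct (jV b) (i1 x)) = i1 (t x b z)) ->
  forall (x y z : subspace M) (a b c : _),
    x (e1 + i1 a) -> y (e2 + i2 b) -> z (e1 + i1 c) ->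
    sGam x o2 y o1 z (e1 + i1 (t a b c)).
Proof.
move=> o1e o1i o2i jVe jUe jUV x y z a b c xa yb zc.
(* Chosen so that the components are c b (e1 + a) in x, c (e2 + b) in y and e1 + c in z, with b and
   c acting as operators. *)
exists (i1 (t a b c) - i1 c), (e1 - opAct (jU c) (i2 b)); split.
- exact: subB.
- by apply: subB => //; apply: sub_act.
- have := sub_act (jU c) (sub_act (jV b) xa).
  by rewrite !opActD jVe jUV => h; mem h.
- by have := sub_act (jU c) yb; rewrite opActD jUe => h; mem h.
- mem zc.
Qed.

(* An associative pair with both products written in the order of matrix
   multiplication, i.e. tV x y z stands for <z y x>^-. *)
Record matrix_pair (K : pzRingType) (U V : lmodType K)
    (tU : U -> V -> U -> U) (tV : V -> U -> V -> V) : Prop := MatrixPair {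
  tU_linear1 : forall y z, linear (fun x => tU x y z);
  tU_linear2 : forall x z, linear (fun y => tU x y z);
  tU_linear3 : forall x y, linear (fun z => tU x y z);
  tV_linear1 : forall y z, linear (fun x => tV x y z);
  tV_linear2 : forall x z, linear (fun y => tV x y z);
  tV_linear3 : forall x y, linear (fun z => tV x y z);
  tUA : forall x y z u v, tU (tU x y z) u v = tU x (tV y z u) v;
  tUAr : forall x y z u v, tU x y (tU z u v) = tU x (tV y z u) v;
  tVA : forall x y z u v, tV (tV x y z) u v = tV x (tU y z u) v;
  tVAr : forall x y z u v, tV x y (tV z u v) = tV x (tU y z u) v
}.

Lemma matrix_pair_swap (K : pzRingType) (U V : lmodType K)
    (tU : U -> V -> U -> U) (tV : V -> U -> V -> V) :
  matrix_pair tU tV -> matrix_pair tV tU.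
Proof. by case=> *; split. Qed.

Lemma linear_fun0 (K : pzRingType) (U V : lmodType K) (f : U -> V) :
  linear f -> f 0 = 0.
Proof. by move=> /linear_pack[F FE]; rewrite -FE linear0. Qed.

(* Half of the standard imbedding of an associative pair (U, V) = (A_qp, A_pq):
   a triple ((f, g), y) in [peirce_row V U] stands for an element of A_pp + A_pq, where
   the A_pp part is known only through its left action f on V and its right
   action g on U. *)
Section Rows.
Variables (K : pzRingType) (U V : lmodType K).
Variables (tU : U -> V -> U -> U) (tV : V -> U -> V -> V).
Hypothesis mp : matrix_pair tU tV.

Definition peirce_row (V U : lmodType K) : lmodType K :=
  ((V -> V) * (U -> U) * V)%type.

Definition row_unit (V U : lmodType K) : peirce_row V U := ((id, id), 0).
Definition row_in (V U : lmodType K) (y : V) : peirce_row V U := (0, y).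
Definition row_diag (V U : lmodType K) (r : peirce_row V U) : peirce_row V U := (r.1, 0).
Definition row_offdiag (V U : lmodType K) (r : peirce_row V U) : peirce_row V U :=
  (0, r.2).

(** This and [row_mulU] are right multiplication by v in A_pq, which kills the A_pq part, and by u
    in A_qp, which kills the A_pp part. *)
Definition row_mulV (v : V) (r : peirce_row V U) : peirce_row V U := (0, r.1.1 v).
Definition row_mulU (u : U) (r : peirce_row V U) : peirce_row V U :=
  ((fun w => tV r.2 u w, fun z => tU z r.2 u), 0).

Lemma row_diag_linear : linear (@row_diag V U).
Proof. by move=> r u v; congr pair; rewrite /= scaler0 addr0. Qed.

Lemma row_offdiag_linear : linear (@row_offdiag V U).
Proof. by move=> r u v; congr pair; rewrite /= scaler0 addr0. Qed.

Lemma row_in_linear : linear (@row_in V U).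
Proof. by move=> r u v; congr pair; rewrite /= scaler0 addr0. Qed.

Lemma row_mulV_linear v : linear (row_mulV v).
Proof. by move=> r u w; congr pair; rewrite /= scaler0 addr0. Qed.

Lemma row_mulU_linear u : linear (row_mulU u).
Proof.
move=> r v w; congr pair; last by rewrite /= scaler0 addr0.
congr pair; apply/funext => z; first exact: tV_linear1 mp _ _ _ _ _.
exact: tU_linear2 mp _ _ _ _ _.
Qed.

(** Left multiplication by [a] in A_qp, with values in A_qq + A_qp. *)
Definition row_left (a : U) (r : peirce_row V U) : peirce_row U V :=
  ((fun z => tU a r.2 z, fun w => tV w a r.2), r.1.2 a).

(** The two actions of one element m of A_pp satisfy (a m) y = a (m y), tested by multiplying with U
    on the right and V on the left. *)
Definition row_compat (r : peirce_row V U) : Prop :=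
  (forall a y z, tU (r.1.2 a) y z = tU a (r.1.1 y) z) /\
  (forall w a y, tV w (r.1.2 a) y = tV w a (r.1.1 y)).

Definition row_graph (a : U) (r : peirce_row V U) (r' : peirce_row U V) : Prop :=
  row_compat r /\ r' = row_left a r.

Let tU02 x z : tU x 0 z = 0. Proof. exact: linear_fun0 (tU_linear2 mp x z). Qed.
Let tV03 x y : tV x y 0 = 0. Proof. exact: linear_fun0 (tV_linear3 mp x y). Qed.

Lemma row_compat_diag0 (y : V) : row_compat (row_in U y).
Proof.
split=> [a v z|w a v] /=.
  by rewrite tU02 (linear_fun0 (tU_linear1 mp v z)).
by rewrite tV03 (linear_fun0 (tV_linear2 mp w v)).
Qed.

Lemma row_graph0 a r' : row_graph a 0 r' -> r' = 0.
Proof.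
case=> _ ->; congr pair; congr pair; apply/funext => w /=; first exact: tU02.
exact: tV03.
Qed.

Lemma row_graph_unit a : row_graph a (row_unit V U) (row_in V a).
Proof.
split=> //; congr pair; congr pair; apply/funext => w /=; first by rewrite tU02.
by rewrite tV03.
Qed.

Lemma row_graphP a c r r' s s' : row_graph a r r' -> row_graph a s s' ->
  row_graph a (c *: r + s) (c *: r' + s').
Proof.
move=> [[cr1 cr2] ->] [[cs1 cs2] ->]; split.
- split=> [b y z|w b y] /=.
    by rewrite (tU_linear1 mp) (tU_linear2 mp) cr1 cs1.
  by rewrite (tV_linear2 mp) (tV_linear3 mp) cr2 cs2.
- congr pair; congr pair; apply/funext => w /=.
    by rewrite (tU_linear2 mp).
  by rewrite (tV_linear3 mp).
Qed.

(** Right multiplication by the idempotent p keeps the column A_pp, A_qp: the diagonal part of one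
    row and the off-diagonal part of the other. *)
Lemma row_graph_diag a r r' :
  row_graph a r r' -> row_graph a (row_diag r) (row_offdiag r').
Proof.
move=> [cr ->]; split=> //; congr pair; congr pair; apply/funext => w /=.
  by rewrite tU02.
by rewrite tV03.
Qed.

Lemma row_graph_offdiag a r r' :
  row_graph a r r' -> row_graph a (row_offdiag r) (row_diag r').
Proof. by move=> [_ ->]; split=> //; apply: row_compat_diag0. Qed.

End Rows.

(** Compatibility enters here: (a m) v = a (m v) for the diagonal part m of [r]. *)
Lemma row_graph_mulV (K : pzRingType) (U V : lmodType K)
    (tU : U -> V -> U -> U) (tV : V -> U -> V -> V) (mp : matrix_pair tU tV)
    a v (r : peirce_row V U) (r' : peirce_row U V) :
  row_graph tU tV a r r' -> row_graph tU tV a (row_mulV v r) (row_mulU tV tU v r').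
Proof.
move=> [[cr1 cr2] ->]; split; first exact: row_compat_diag0.
congr pair; congr pair; apply/funext => w /=; first exact: cr1.
exact: cr2.
Qed.

Lemma row_graph_mulU (K : pzRingType) (U V : lmodType K)
    (tU : U -> V -> U -> U) (tV : V -> U -> V -> V) (mp : matrix_pair tU tV)
    a u (r : peirce_row V U) (r' : peirce_row U V) :
  row_graph tU tV a r r' -> row_graph tU tV a (row_mulU tU tV u r) (row_mulV u r').
Proof.
move=> [_ ->]; split.
- split=> [b y z|w b y] /=; first exact: tUA mp _ _ _ _ _.
  by rewrite (tVAr mp).
- congr pair; congr pair; apply/funext => w /=.
    by rewrite (linear_fun0 (tU_linear2 mp _ _)).
  by rewrite (linear_fun0 (tV_linear3 mp _ _)).
Qed.

(** * The operator module of an associative pair: both Peirce rows together *)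

Section PairModule.
Variables (K : comPzRingType) (U V : lmodType K).
Variables (tU : U -> V -> U -> U) (tV : V -> U -> V -> V).
Hypothesis mp : matrix_pair tU tV.
Let mp' := matrix_pair_swap mp.

Local Notation W := (peirce_row V U * peirce_row U V)%type.

(* The booleans are the two Peirce projections. *)
Definition pair_act (i : U + V + bool) (w : W) : W :=
  match i with
  | inl (inl u) => (row_mulU tU tV u w.1, row_mulV u w.2)
  | inl (inr v) => (row_mulV v w.1, row_mulU tV tU v w.2)
  | inr true => (row_diag w.1, row_offdiag w.2)
  | inr false => (row_offdiag w.1, row_diag w.2)
  end.

Fact pair_act_linear i : linear (pair_act i).
Proof.
move=> r [u1 u2] [v1 v2]; case: i => [[u|v]|[]]; congr pair;
  by rewrite /= ?(row_mulU_linear mp) ?(row_mulU_linear mp') ?row_mulV_linear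
    ?row_diag_linear ?row_offdiag_linear.
Qed.

Definition pair_e1 : W := (row_unit V U, 0).
Definition pair_e2 : W := (0, row_unit U V).

Let act0 i : pair_act i 0 = 0.
Proof. exact: linear_fun0 (pair_act_linear i). Qed.

(** The diagonal parts of [W] range over arbitrary functions, so the whole space is cut down to the
    sum of the subspaces generated by the two idempotents. *)
Fact pair_whole_stable : stable pair_act (fun w =>
  exists2 u, gen pair_act pair_e1 u & gen pair_act pair_e2 (w - u)).
Proof.
have [p0 pD pA] := gen_stable pair_act pair_e1.
have [q0 qD qA] := gen_stable pair_act pair_e2.
split; first by exists 0; rewrite ?subr0.
- move=> r w w' [u pu qu] [u' pu' qu']; exists (r *: u + u'); first exact: pD.
  have -> : r *: w + w' - (r *: u + u') = r *: (w - u) + (w' - u').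
    by rewrite scalerBr opprD addrACA.
  exact: qD.
- move=> i w [u pu qu]; exists (pair_act i u); first exact: pA.
  have -> : pair_act i w - pair_act i u = pair_act i (w - u).
    by rewrite [w - u]addrC -scaleN1r pair_act_linear scaleN1r addrC.
  exact: qA.
Qed.

Definition pair_module : opModule K := OpModule pair_act_linear pair_whole_stable.

Fact gen_e1_whole w : gen pair_act pair_e1 w -> @whole K pair_module w.
Proof.
by exists w => //; rewrite subrr; case: (gen_stable pair_act pair_e2).
Qed.
Fact gen_e2_whole w : gen pair_act pair_e2 w -> @whole K pair_module w.
Proof.
by exists 0; rewrite ?subr0 //; case: (gen_stable pair_act pair_e1).
Qed.

Definition pair_p : subspace pair_module :=
  @Subspace K pair_module _ (gen_stable pair_act pair_e1) gen_e1_whole.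
Definition pair_q : subspace pair_module :=
  @Subspace K pair_module _ (gen_stable pair_act pair_e2) gen_e2_whole.

Definition pair_inU (a : U) : pair_module := (0, row_in V a).
Definition pair_inV (b : V) : pair_module := (row_in U b, 0).

Lemma pair_p0 w : pair_p w -> w.2 = 0.
Proof.
move=> gw; apply: (gw (fun w : W => w.2 = 0)) => //; split=> // [r u v /= -> ->|].
  by rewrite scaler0 addr0.
by move=> i [u1 u2] /= ->; have := congr1 snd (act0 i); case: i => [[u|v]|[]].
Qed.

Lemma pair_q0 w : pair_q w -> w.1 = 0.
Proof.
move=> gw; apply: (gw (fun w : W => w.1 = 0)) => //; split=> // [r u v /= -> ->|].
  by rewrite scaler0 addr0.
by move=> i [u1 u2] /= ->; have := congr1 fst (act0 i); case: i => [[u|v]|[]].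
Qed.

Lemma pair_actU_e2 a : pair_act (inl (inl a)) pair_e2 = pair_inU a.
Proof. by congr pair; apply: linear_fun0 (row_mulU_linear mp a). Qed.

Lemma pair_actV_e1 b : pair_act (inl (inr b)) pair_e1 = pair_inV b.
Proof. by congr pair; apply: linear_fun0 (row_mulU_linear mp' b). Qed.

Lemma pair_q_inU a : pair_q (pair_inU a).
Proof.
rewrite -pair_actU_e2.
apply: (@sub_act K pair_module pair_q (inl (inl a)) pair_e2).
exact: gen_id.
Qed.

Lemma pair_p_inV b : pair_p (pair_inV b).
Proof.
rewrite -pair_actV_e1.
apply: (@sub_act K pair_module pair_p (inl (inr b)) pair_e1).
exact: gen_id.
Qed.

(** Left multiplication by [a] commutes with the operators, so the generated subspace stays inside
    its graph, while the first row vanishes on [pair_q]. *)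
Lemma pair_graph_disjU a (w : W) :
  gen pair_act (pair_e1 + pair_inU a) w -> pair_q w -> w = 0.
Proof.
move=> gw /pair_q0 w10; have := gw (fun w : W => row_graph tU tV a w.1 w.2).
rewrite w10 => /(_ _ _)/(row_graph0 mp) h.
case: w w10 {gw} h => w1 w2 /= -> h; congr pair; apply: h.
- split=> [|r u v|i u].
  + split; first exact: (row_compat_diag0 mp).
    by congr pair; congr pair; apply/funext => x /=;
      rewrite ?(linear_fun0 (tU_linear2 mp _ _)) ?(linear_fun0 (tV_linear3 mp _ _)).
  + exact: row_graphP.
  + case: i => [[x|y]|[]] /=; [exact: row_graph_mulU|exact: row_graph_mulV|
      exact: row_graph_diag|exact: row_graph_offdiag].
- by rewrite /= addr0 add0r; apply: row_graph_unit.
Qed.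

Lemma pair_graph_disjV b (w : W) :
  gen pair_act (pair_e2 + pair_inV b) w -> pair_p w -> w = 0.
Proof.
move=> gw /pair_p0 w20; have := gw (fun w : W => row_graph tV tU b w.2 w.1).
rewrite w20 => /(_ _ _)/(row_graph0 mp') h.
case: w w20 {gw} h => w1 w2 /= -> h; congr pair; apply: h.
- split=> [|r u v|i u].
  + split; first exact: (row_compat_diag0 mp').
    by congr pair; congr pair; apply/funext => x /=;
      rewrite ?(linear_fun0 (tU_linear2 mp' _ _)) ?(linear_fun0 (tV_linear3 mp' _ _)).
  + exact: row_graphP.
  + case: i => [[x|y]|[]] /=; [exact: row_graph_mulV|exact: row_graph_mulU|
      exact: row_graph_offdiag|exact: row_graph_diag].
- by rewrite /= addr0 add0r; apply: row_graph_unit.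
Qed.

Lemma pair_isoU (o : {x : subspace pair_module | x \in Cset pair_q}) :
  sval o = pair_p -> exists F : {linear U -> affmod o},
    [/\ bijective F, forall a, sval (F a) ((pair_e1 : pair_module) + pair_inU a)
      & forall a (x : affmod o),
          sval x ((pair_e1 : pair_module) + pair_inU a) -> F a = x].
Proof.
(* [inr true] fixes [pair_e1] and projects the second row, where [pair_q] lives, onto its part in
   U. *)
apply: (@complement_iso K pair_module U pair_p pair_q pair_e1 pair_inU (inr true)).
- by move=> r a b; congr pair; rewrite ?row_in_linear //= scaler0 addr0.
- by move=> a b [].
- exact: gen_id.
- by [].
- exact: pair_q_inU.
- by congr pair.
- by move=> [n1 n2] /pair_q0 /= ->; exists n2.2.
- by [].
- exact: pair_graph_disjU.
Qed.

Lemma pair_isoV (o : {x : subspace pair_module | x \in Cset pair_p}) :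
  sval o = pair_q -> exists F : {linear V -> affmod o},
    [/\ bijective F, forall b, sval (F b) ((pair_e2 : pair_module) + pair_inV b)
      & forall b (x : affmod o),
          sval x ((pair_e2 : pair_module) + pair_inV b) -> F b = x].
Proof.
apply: (@complement_iso K pair_module V pair_q pair_p pair_e2 pair_inV (inr false)).
- by move=> r a b; congr pair; rewrite ?row_in_linear //= scaler0 addr0.
- by move=> a b [].
- exact: gen_id.
- by [].
- exact: pair_p_inV.
- by congr pair.
- by move=> [n1 n2] /pair_p0 /= ->; exists n1.2.
- move=> w [u pu qu]; exists (w - u) => //.
  by rewrite subKr.
- exact: pair_graph_disjV.
Qed.

Lemma pair_trans : transversal_pair pair_p pair_q.
Proof.
apply/complementP; split=> [[w1 w2] /pair_p0 /= -> /pair_q0 /= -> //|w].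
by [].
Qed.

Lemma pair_GamU (x y z : subspace pair_module) a b c :
  x ((pair_e1 : pair_module) + pair_inU a) ->
  y ((pair_e2 : pair_module) + pair_inV b) ->
  z ((pair_e1 : pair_module) + pair_inU c) ->
  sGam x pair_q y pair_p z ((pair_e1 : pair_module) + pair_inU (tU a b c)).
Proof.
apply: (Gam_triple (M := pair_module) (i1 := pair_inU) (i2 := pair_inV)
  (jU := fun u => inl (inl u)) (jV := fun v => inl (inr v))).
- exact: gen_id.
- exact: pair_p_inV.
- exact: pair_q_inU.
- exact: pair_actV_e1.
- exact: pair_actU_e2.
- move=> x' b' z'; congr pair.
  exact: linear_fun0 (row_mulU_linear mp z').
Qed.

Lemma pair_GamV (x y z : subspace pair_module) a b c :
  x ((pair_e2 : pair_module) + pair_inV a) ->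
  y ((pair_e1 : pair_module) + pair_inU b) ->
  z ((pair_e2 : pair_module) + pair_inV c) ->
  sGam x pair_p y pair_q z ((pair_e2 : pair_module) + pair_inV (tV a b c)).
Proof.
apply: (Gam_triple (M := pair_module) (i1 := pair_inV) (i2 := pair_inU)
  (jU := fun v => inl (inr v)) (jV := fun u => inl (inl u))).
- exact: gen_id.
- exact: pair_q_inU.
- exact: pair_p_inV.
- exact: pair_actU_e2.
- exact: pair_actV_e1.
- move=> x' b' z'; congr pair.
  exact: linear_fun0 (row_mulU_linear mp' z').
Qed.

End PairModule.

Lemma assocPair_matrix (K : comPzRingType) (A : assocPair K) :
  matrix_pair (@prodp K A) (fun x y z => prodm z y x).
Proof.
split=> /=.
- exact: prodp_linear1.
- exact: prodp_linear2.
- exact: prodp_linear3.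
- by move=> y z; apply: prodm_linear3.
- by move=> x z; apply: prodm_linear2.
- by move=> x y; apply: prodm_linear1.
- exact: prodpAC.
- by move=> x y z u v; rewrite prodpA prodpAC.
- by move=> x y z u v; rewrite prodmA prodmAC.
- by move=> x y z u v; rewrite prodmAC.
Qed.

Lemma pair_geometry (K : comPzRingType) (A : assocPair K) :
  exists (d : Order.disp_t) (X : assocGeometryType K d) (op om : X)
    (tr : transversal_pair op om), pair_isomorphic A (associated_pair tr).
Proof.
have mp := assocPair_matrix A; pose M := pair_module mp.
exists (Order.Disp tt tt), (subspace M), (pair_p mp), (pair_q mp), (pair_trans mp).
have [Fp [bFp Fpin FpP]] := pair_isoU (o := originp (pair_trans mp)) erefl.
have [Fm [bFm Fmin FmP]] := pair_isoV (o := originm (pair_trans mp)) erefl.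
exists Fp, Fm; split=> // x y z.
- by apply: FpP; apply: pair_GamU.
(* The minus product was reversed to matrix order, so x and z are exchanged and the product is
   turned back. *)
- by apply: FmP; have := pair_GamV (Fmin z) (Fpin y) (Fmin x); rewrite sGam_rev.
Qed.

Theorem theorem3p4 (K : comPzRingType) :
  (forall A : assocPair K,
    exists (d : Order.disp_t) (X : assocGeometryType K d) (op om : X)
      (tr : transversal_pair op om),
      pair_isomorphic A (associated_pair tr)) /\
  (forall A : unitalAlg K,
    exists (d : Order.disp_t) (X : assocGeometryType K d) (op Delta om : X)
      (tr : transversal_triple op Delta om),
      alg_isomorphic A (associated_algebra tr)).
Proof. by split=> A; [apply: pair_geometry|apply: alg_geometry]. Qed.
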